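(* Let $(E,\mathcal{F})$ be a measurable space and let $(\mu_n)_{n\in\mathbb{N}}\subset\mathcal{P}(E)$ be a sequence of probability measures converging to $\mu\in\mathcal{P}(E)$ in the Hilbert projective metric, i.e. $\mathcal{H}(\mu_n,\mu)\to0$. Then, for any $f$-divergence $D_f$, $D_f(\mu_n\|\mu)\to 0$ and $D_f(\mu\|\mu_n)\to0$ as $n\to\infty$ (both quantities being defined for all $n$ large enough, since $\mu_n\sim\mu$ whenever $\mathcal{H}(\mu_n,\mu)<\infty$).
   Context: $f$-divergence: let $f:\mathbb{R}_+\to(-\infty,\infty]$ be a convex function with $f(1)=0$ and $f(x)<\infty$ for all $x>0$. For $\mu,\nu\in\mathcal{P}(E)$ with $\mu\ll\nu$, $D_f(\mu\|\nu)=\int_E f\big(\frac{d\mu}{d\nu}\big)\,d\nu$. The Hilbert projective metric on $\mathcal{P}(E)$ is $\mathcal{H}(\mu,\nu)=\log\big(\beta(\mu,\nu)\beta(\nu,\mu)\big)\in[0,\infty]$, where $\beta(\mu,\nu)=\inf\{r>0: r\mu-\nu \text{ is a non-negative measure}\}$ with $\inf\emptyset=\infty$; equivalently $\mathcal{H}(\mu,\nu)=\log\big(\|\tfrac{d\mu}{d\nu}\|_\infty\|\tfrac{d\nu}{d\mu}\|_\infty\big)$ if $\mu\sim\nu$ with essentially bounded densities, and $\infty$ otherwise. *)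

(* Defs.v *)
From HB Require Import structures.
From mathcomp Require Import all_boot all_order all_algebra.
From mathcomp Require Import all_classical all_reals all_analysis.

Set Implicit Arguments.
Unset Strict Implicit.
Unset Printing Implicit Defensive.

Import Order.TTheory GRing.Theory Num.Theory.
Import numFieldNormedType.Exports.

Local Open Scope classical_set_scope.
Local Open Scope ring_scope.
Local Open Scope ereal_scope.

(* A function f : [0, +oo[ -> ]-oo, +oo] is encoded as f : R -> \bar R whose
   values at negative reals are irrelevant (nothing is assumed about them).
   The library's [convex_function] is only for real-valued functions; here
   f 0 = +oo is allowed, and 0 * +oo = 0 makes t = 0 and t = 1 harmless. *)
Definition ereal_convex_nneg (R : realType) (f : R -> \bar R) : Prop :=
  forall x y t : R, (0 <= x)%R -> (0 <= y)%R -> (0 <= t <= 1)%R ->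
    f (t * x + (1 - t) * y)%R <= t%:E * f x + (1 - t)%:E * f y.

Record f_divergence_generator (R : realType) (f : R -> \bar R) : Prop := {
  fdg_gtNy : forall x : R, (0 <= x)%R -> -oo < f x ;
  fdg_convex : ereal_convex_nneg f ;
  fdg_1 : f 1%R = 0 ;
  fdg_lty : forall x : R, (0 < x)%R -> f x < +oo }.

(* Meaningful only if mu `<< nu. In that case [Radon_Nikodym_SigmaFinite.f mu nu]
   is a version of the density of mu w.r.t. nu that is non-negative and finite
   everywhere (contrary to ['d mu '/d nu], defined for signed measures, which
   may be negative on a null set), so f is only evaluated on [0, +oo[. *)
Definition f_divergence d (E : measurableType d) (R : realType)
    (f : R -> \bar R) (mu nu : probability E R) : \bar R :=
  \int[nu]_x f (fine (Radon_Nikodym_SigmaFinite.f mu nu x)).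

(* In \bar R, [ereal_inf set0 = +oo]. *)
Definition hilbert_beta d (E : measurableType d) (R : realType)
    (mu nu : probability E R) : \bar R :=
  ereal_inf [set r%:E | r in [set r : R | (0 < r)%R /\
    forall A : set E, measurable A -> 0 <= r%:E * mu A - nu A]].

Definition hilbert_metric d (E : measurableType d) (R : realType)
    (mu nu : probability E R) : \bar R :=
  lne (hilbert_beta mu nu * hilbert_beta nu mu).

(* Main.v *)
(* If H(P, Q) < ln c, then both betas are < c, because each of them is >= 1; so
   P <= r Q and Q <= r P as measures for some r < c, and the density dP/dQ lies
   Q-a.e. in [1/c, c]. A convex f that is finite on ]0, +oo[ with f 1 = 0 is
   Lipschitz near 1, so |f| <= eps on [1/c, c] for c close to 1, and
   |D_f(P||Q)| <= eps. The hypotheses are symmetric in P and Q. *)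
Require Import Defs.
From HB Require Import structures.
From mathcomp Require Import all_boot all_order all_algebra.
From mathcomp Require Import all_classical all_reals all_analysis.
From mathcomp Require Import measurable_realfun ring lra.

Import Order.TTheory GRing.Theory Num.Theory.
Import numFieldNormedType.Exports.

Local Open Scope classical_set_scope.
Local Open Scope ring_scope.
Local Open Scope ereal_scope.

Set Implicit Arguments.
Unset Strict Implicit.

(** * Size near [1] and measurability of the convex function *)

Section generator.
Context (R : realType) (f : R -> \bar R) (hf : f_divergence_generator f).

Let fin_f (x : R) : (0 < x)%R -> f x = (fine (f x))%:E.
Proof.
by move=> x0; rewrite fineK// fin_numElt (fdg_gtNy hf) ?ltW//= (fdg_lty hf).
Qed.

(** Positive points have positive convex combinations, so all values of [f] involved are finite and
    its convexity becomes a real inequality. *)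
Lemma fine_generator_convex (x y t : R) :
  (0 < x)%R -> (0 < y)%R -> (0 <= t <= 1)%R ->
  (fine (f (t * x + (1 - t) * y)) <= t * fine (f x) + (1 - t) * fine (f y))%R.
Proof.
move=> x0 y0 t01; have /andP[t0 t1] := t01.
have xy0 : (0 < t * x + (1 - t) * y)%R.
  have [->|t_neq0] := eqVneq t 0%R; first by rewrite mul0r add0r subr0 mul1r.
  by rewrite ltr_pwDl ?mulr_gt0 ?mulr_ge0 ?subr_ge0 ?(ltW y0)// lt_neqAle eq_sym t_neq0.
have := fdg_convex hf (ltW x0) (ltW y0) t01.
by rewrite (fin_f xy0) (fin_f x0) (fin_f y0) -!EFinM -EFinD lee_fin.
Qed.

Lemma fine_generator_abs_le :
  exists2 K : R, (0 < K)%R & forall x : R, (`|x - 1| <= 2^-1)%R ->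
    (`|fine (f x)| <= K * `|x - 1|)%R.
Proof.
(* The summand [1] makes [M] positive. *)
pose M := (1 + `|fine (f 2)| + `|fine (f 2^-1)|)%R.
have M2 : (fine (f 2) <= M)%R.
  by have := ler_norm (fine (f 2)); have := normr_ge0 (fine (f 2^-1)); rewrite /M; lra.
have Mh : (fine (f 2^-1) <= M)%R.
  by have := ler_norm (fine (f 2^-1)); have := normr_ge0 (fine (f 2)); rewrite /M; lra.
have M0 : (0 < M)%R.
  by have := normr_ge0 (fine (f 2^-1)); have := normr_ge0 (fine (f 2)); rewrite /M; lra.
have f1 : fine (f 1) = 0%R by rewrite (fdg_1 hf).
(* Chords from [1] to [2] and from [1] to [2^-1] lie above [f]. The second has length [2^-1], whence
   the weight [2 * (1 - x)] and the factor [2]. *)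
have up (x : R) : (`|x - 1| <= 2^-1)%R -> (fine (f x) <= 2 * M * `|x - 1|)%R.
  rewrite ler_distl => /andP[xl xr]; have [x1|x1] := leP 1%R x.
  - rewrite ger0_norm ?subr_ge0//.
    have := @fine_generator_convex 2 1 (x - 1) ltac:(lra) ltac:(lra) ltac:(lra).
    rewrite f1 mulr0 addr0 (_ : ((x - 1) * 2 + (1 - (x - 1)) * 1)%R = x); last by ring.
    by nra.
  - rewrite ltr0_norm ?subr_lt0//.
    have := @fine_generator_convex 2^-1 1 (2 * (1 - x)) ltac:(lra) ltac:(lra) ltac:(lra).
    rewrite f1 mulr0 addr0.
    rewrite (_ : (2 * (1 - x) * 2^-1 + (1 - 2 * (1 - x)) * 1)%R = x); last by field.
    by nra.
exists (2 * M)%R => [|x x1]; first lra.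
(* The lower bound at [x] is the upper bound at the reflection of [x] about
   [1], by midpoint convexity and [f 1 = 0]. *)
have refl1 : (`|(2 - x) - 1| = `|x - 1|)%R.
  by rewrite -normrN; congr (`|_|)%R; ring.
have x'1 : (`|(2 - x) - 1| <= 2^-1)%R by rewrite refl1.
have upx := up _ x1; have upx' := up _ x'1.
move: x1; rewrite ler_distl => /andP[xl xr].
have := @fine_generator_convex x (2 - x) 2^-1 ltac:(lra) ltac:(lra) ltac:(lra).
rewrite (_ : (2^-1 * x + (1 - 2^-1) * (2 - x))%R = 1%R); last by field.
rewrite f1 refl1 in upx' *.
by rewrite ler_norml upx andbT; lra.
Qed.

Lemma generator_small_near1 (eps : R) : (0 < eps)%R ->
  exists2 c : R, (1 < c)%R & forall x : R, (c^-1 <= x <= c)%R ->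
    `|f x| <= eps%:E.
Proof.
move=> eps0; have [K K0 fK] := fine_generator_abs_le.
pose a := Num.min 2^-1%R (eps / K)%R.
have a0 : (0 < a)%R by rewrite lt_min invr_gt0 ltr0n divr_gt0.
have ah : (a <= 2^-1)%R by rewrite ge_min lexx.
exists (1 + a)%R => [|x /andP[xl xr]]; first lra.
(* On the left, [(1 - a) * (1 + a) <= 1] gives [1 - a <= c^-1] with [c = 1 + a]. *)
have xa : (`|x - 1| <= a)%R.
  rewrite ler_distl -(addrC a) addrC xr andbT (le_trans _ xl)//.
  by rewrite -[leRHS]mul1r ler_pdivlMr; nra.
have x0 : (0 < x)%R by rewrite (lt_le_trans _ xl)// invr_gt0; lra.
rewrite (fin_f x0) abse_EFin lee_fin (le_trans (fK _ (le_trans xa ah)))//.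
by rewrite mulrC -ler_pdivlMr// (le_trans xa)// ge_min lexx orbT.
Qed.

(* Sublevel sets of a convex function are intervals. *)
Lemma measurable_generator : measurable_fun (`[0%R, +oo[ : set R) f.
Proof.
apply: (measurability _ (ErealGenInftyO.measurableE R)) => _ [_ [r ->] <-].
apply: is_interval_measurable => x y /=.
rewrite !in_itv/= !andbT => -[x0 fx] [y0 fy] z /andP[xz zy].
rewrite !in_itv/= andbT; split; first exact: le_trans x0 xz.
have [xy|xy] := eqVneq x y.
  by have <- : x = z by apply/le_anti; rewrite xz xy zy.
have yx0 : (0 < y - x)%R.
  by rewrite subr_gt0 lt_neqAle xy (le_trans xz zy).
pose t := ((y - z) / (y - x))%R.
have t01 : (0 <= t <= 1)%R.
  by rewrite /t divr_ge0 ?(ltW yx0) ?subr_ge0//= ler_pdivrMr// mul1r lerB.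
have zE : z = (t * x + (1 - t) * y)%R.
  by rewrite /t; field; rewrite gt_eqF.
have := fdg_convex hf x0 y0 t01; rewrite -zE => /le_lt_trans; apply.
(* An endpoint may be [0], where [f] may be [+oo]; finiteness comes from lying below the real
   [r]. *)
have fx_fin : f x = (fine (f x))%:E.
  by rewrite fineK// fin_numElt (fdg_gtNy hf)//= (lt_trans fx)// ltry.
have fy_fin : f y = (fine (f y))%:E.
  by rewrite fineK// fin_numElt (fdg_gtNy hf)//= (lt_trans fy)// ltry.
move: fx fy; rewrite fx_fin fy_fin -!EFinM -EFinD !lte_fin => fx fy.
(* For [t > 0] the weight of [x] keeps the inequality strict; for [t = 0] only [y] remains. *)
case/andP: t01; rewrite le_eqVlt => /predU1P[<-|t0] t1.
  by rewrite mul0r add0r subr0 mul1r.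
by nra.
Qed.

End generator.

(** * From the Hilbert metric to domination of measures *)

Section hilbert.
Context (R : realType) d (E : measurableType d).
Implicit Types P Q : probability E R.

Lemma hilbert_beta_ge1 P Q : 1 <= hilbert_beta P Q.
Proof.
apply: le_ereal_inf_tmp => _ [r [_ rPQ] <-]; have := rPQ _ measurableT.
by rewrite !probability_setT mule1 sube_ge0.
Qed.

Lemma hilbert_beta_lt P Q (c : \bar R) : hilbert_beta P Q < c ->
  exists2 r : R, r%:E < c & forall A, measurable A -> Q A <= r%:E * P A.
Proof.
move=> /ereal_inf_lt[_ [r [r0 rPQ] <-] rc]; exists r => // A mA.
by rewrite -sube_ge0 ?rPQ// fin_num_measure ?orbT.
Qed.

(** Taking [c] in [\bar R] also covers [c = +oo], where it says that a finite metric makes both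
    factors finite. *)
Lemma hilbert_metric_lt P Q (c : \bar R) : 0 <= c ->
  hilbert_metric P Q < lne c -> hilbert_beta P Q < c /\ hilbert_beta Q P < c.
Proof.
move=> c0; have PQ := hilbert_beta_ge1 P Q; have QP := hilbert_beta_ge1 Q P.
have PQ0 := le_trans lee01 PQ; have QP0 := le_trans lee01 QP.
rewrite /hilbert_metric lte_lne ?in_itv/= ?leey ?mule_ge0 ?c0//.
by move=> ltc; split; apply: le_lt_trans ltc; [exact: lee_pemulr|exact: lee_pemull].
Qed.

Lemma hilbert_metric_lty_dominates P Q : hilbert_metric P Q < +oo ->
  P `<< Q /\ Q `<< P.
Proof.
move=> /(@hilbert_metric_lt _ _ +oo (leey _))[] ltPQ ltQP.
have dom P' Q' : hilbert_beta P' Q' < +oo -> Q' `<< P'.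
  move=> /hilbert_beta_lt[r _ QrP]; apply/null_content_dominatesP => A mA PA0.
  by apply/le_anti; rewrite measure_ge0 (le_trans (QrP _ mA))// PA0 mule0.
by split; exact: dom.
Qed.

End hilbert.

(** * Bounds on the density and on the divergence *)

Section density.
Context (R : realType) d (E : measurableType d) (P Q : probability E R).
Hypothesis PQ : P `<< Q.
Local Notation p := (Radon_Nikodym_SigmaFinite.f P Q).

Let mp : measurable_fun setT p.
Proof. exact: measurable_int (Radon_Nikodym_SigmaFinite.f_integrable PQ). Qed.

Let mul_le_eq0 (r c : R) (x : \bar R) : (r < c)%R -> x \is a fin_num ->
  0 <= x -> c%:E * x <= r%:E * x -> x = 0.
Proof.
case: x => // x rc _; rewrite -!EFinM !lee_fin => x0 cr.
by congr EFin; apply/le_anti; rewrite x0 andbT; nra.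
Qed.

(** On [A], where [c <= p], integration gives [c * Q A <= P A <= r * Q A], so [Q A = 0] since
    [r < c]. *)
Lemma ae_density_le (r c : R) : (0 <= c)%R -> (r < c)%R ->
  (forall A, measurable A -> P A <= r%:E * Q A) ->
  {ae Q, forall x, p x <= c%:E}.
Proof.
move=> c0 rc PrQ; pose A := [set x | c%:E <= p x].
have mA : measurable A.
  by rewrite -[A]setTI; exact: emeasurable_fun_c_infty.
exists A; split => //; last by move=> x /= /negP; rewrite -ltNge => /ltW.
apply: (mul_le_eq0 rc) => //; first exact: fin_num_measure.
rewrite (le_trans _ (PrQ _ mA))// (Radon_Nikodym_SigmaFinite.f_integral PQ)//.
rewrite -integral_cst//; apply: ge0_le_integral => //.
- exact: measurable_funTS.
Qed.

(** On [A], where [p <= c^-1], one has [c * P A <= Q A <= r * P A]. Hence [P A = 0], and then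
    [Q A = 0] by domination. *)
Lemma ae_density_ge (r c : R) : (0 <= r)%R -> (r < c)%R ->
  (forall A, measurable A -> Q A <= r%:E * P A) ->
  {ae Q, forall x, c^-1%:E <= p x}.
Proof.
move=> r0 rc QrP; have c0 : (0 < c)%R by exact: le_lt_trans rc.
pose A := [set x | p x <= c^-1%:E].
have mA : measurable A.
  by rewrite -[A]setTI; exact: emeasurable_fun_infty_c.
exists A; split => //; last by move=> x /= /negP; rewrite -ltNge => /ltW.
have PA : P A <= c^-1%:E * Q A.
  rewrite (Radon_Nikodym_SigmaFinite.f_integral PQ)// -integral_cst//.
  apply: ge0_le_integral => //.
  - by move=> x _; exact: Radon_Nikodym_SigmaFinite.f_ge0.
  - exact: measurable_funTS.
have PA0 : P A = 0.
  apply: (mul_le_eq0 rc) => //; first exact: fin_num_measure.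
  rewrite (le_trans _ (QrP _ mA))//.
  rewrite (le_trans (lee_wpmul2l _ PA)) ?lee_fin ?(ltW c0)//.
  by rewrite muleA -EFinM divff ?gt_eqF// mul1e.
by apply/le_anti; rewrite measure_ge0 (le_trans (QrP _ mA))// PA0 mule0.
Qed.

Lemma f_divergence_abs_le (f : R -> \bar R) (c eps : R) :
  f_divergence_generator f -> (1 <= c)%R ->
  {ae Q, forall x, c^-1%:E <= p x} -> {ae Q, forall x, p x <= c%:E} ->
  (forall x : R, (c^-1 <= x <= c)%R -> `|f x| <= eps%:E) ->
  `|f_divergence f P Q| <= eps%:E.
Proof.
move=> hf c1 pge ple feps.
have p0 x : 0 <= p x by exact: Radon_Nikodym_SigmaFinite.f_ge0.
have pE x : p x = (fine (p x))%:E.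
  by rewrite fineK//; exact: Radon_Nikodym_SigmaFinite.f_fin_num.
have eps0 : 0 <= eps%:E.
  apply: le_trans (feps 1%R _); first exact: abse_ge0.
  by rewrite c1 andbT invf_le1// (lt_le_trans ltr01).
(* [f] is known to be measurable only on [[0, +oo[], which contains the range of the density. *)
have mfp : measurable_fun setT (fun x => f (fine (p x))).
  apply: (@measurable_comp _ _ _ _ _ _ (`[0%R, +oo[ : set R) f _ (fine \o p)) => //.
  - by move=> _ [x _ <-]; rewrite /= in_itv/= andbT fine_ge0.
  - exact: measurable_generator.
  - exact: measurableT_comp.
rewrite (le_trans (le_abse_integral _ _ mfp))//.
rewrite -[leRHS]mule1 -(probability_setT Q) -integral_cst//.
apply: ae_ge0_le_integral => //; first exact: measurableT_comp.
apply: filterS2 pge ple => x cp pc _ /=; apply: feps.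
by move: cp pc; rewrite pE !lee_fin => -> ->.
Qed.

End density.

(** * Uniform smallness and passage to the limit *)

Lemma hilbert_metric_f_divergence_le (R : realType) d (E : measurableType d)
    (f : R -> \bar R) (hf : f_divergence_generator f) (eps : R) :
  (0 < eps)%R -> exists2 delta : R, (0 < delta)%R &
    forall P Q : probability E R, hilbert_metric P Q < delta%:E ->
      `|f_divergence f P Q| <= eps%:E /\ `|f_divergence f Q P| <= eps%:E.
Proof.
move=> eps0; have [c c1 feps] := generator_small_near1 hf eps0.
have c0 : (0 < c)%R := lt_trans ltr01 c1.
exists (ln c) => [|P Q]; first exact: ln_gt0.
rewrite -lne_EFin// => PQc.
have [|domPQ domQP] := @hilbert_metric_lty_dominates _ _ _ P Q.
  by rewrite (lt_trans PQc)// lne_EFin// ltry.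
have [|/hilbert_beta_lt[r rc QrP] /hilbert_beta_lt[s sc PsQ]] :=
  hilbert_metric_lt _ PQc; first by rewrite lee_fin ltW.
rewrite lte_fin in rc; rewrite lte_fin in sc.
(* On the whole space the domination reads [1 <= t]. *)
have ge0 P' Q' (t : R) : (forall A, measurable A ->
    (Q' : probability E R) A <= t%:E * (P' : probability E R) A) -> (0 <= t)%R.
  move=> /(_ _ measurableT); rewrite !probability_setT mule1 lee_fin.
  exact: le_trans.
(* Each domination serves twice: [Q <= r P] bounds [dP/dQ] below and [dQ/dP] above, and [P <= s Q]
   does the converse. *)
split; apply: (f_divergence_abs_le _ hf (ltW c1)) => //.
- exact: ae_density_ge (ge0 _ _ _ QrP) rc QrP.
- exact: ae_density_le (ltW c0) sc PsQ.
- exact: ae_density_ge (ge0 _ _ _ PsQ) sc PsQ.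
- exact: ae_density_le (ltW c0) rc QrP.
Qed.

Lemma cvge0_abse_le (R : realType) (u : nat -> \bar R) :
  (forall eps : R, (0 < eps)%R -> \forall n \near \oo, `|u n| <= eps%:E) ->
  u n @[n --> \oo] --> (0 : \bar R).
Proof.
move=> ule; apply/fine_cvgP; split.
  (* The bound with [eps = 1] makes [u] eventually finite, which reduces the claim to real
     convergence. *)
  apply: filterS (ule 1%R ltr01) => n un.
  by rewrite -abse_fin_num ge0_fin_numE// (le_lt_trans un)// ltry.
apply/cvgr0Pnorm_le => eps eps0; apply: filterS (ule _ eps0) => n un /=.
have ufin : u n \is a fin_num.
  by rewrite -abse_fin_num ge0_fin_numE// (le_lt_trans un)// ltry.
by rewrite -lee_fin -abse_EFin fineK.
Qed.

Unset Implicit Arguments.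

Theorem proposition3p10 (R : realType) (d : measure_display)
    (E : measurableType d) (mu_ : nat -> probability E R)
    (mu : probability E R)
    (cvg_mu : hilbert_metric (mu_ n) mu @[n --> \oo] --> (0 : \bar R))
    (f : R -> \bar R) (hf : f_divergence_generator f) :
  [/\ (forall n, hilbert_metric (mu_ n) mu < +oo ->
        mu_ n `<< mu /\ mu `<< mu_ n),
      (\forall n \near \oo, mu_ n `<< mu /\ mu `<< mu_ n),
      f_divergence f (mu_ n) mu @[n --> \oo] --> (0 : \bar R) &
      f_divergence f mu (mu_ n) @[n --> \oo] --> (0 : \bar R)].
Proof.
have near_lt (delta : R) : (0 < delta)%R ->
    \forall n \near \oo, hilbert_metric (mu_ n) mu < delta%:E.
  (* This set is an open neighbourhood of [0] in [\bar R]. *)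
  move=> delta0; apply: (cvg_mu [set x | x < delta%:E]).
  exact: open_ereal_lt'.
split.
- by move=> n; exact: hilbert_metric_lty_dominates.
- apply: filterS (near_lt 1%R ltr01) => n H1.
  by apply: hilbert_metric_lty_dominates; rewrite (lt_trans H1)// ltry.
all: apply: cvge0_abse_le => eps eps0;
  have [delta delta0 Hle] := hilbert_metric_f_divergence_le E hf eps0;
  by apply: filterS (near_lt _ delta0) => n /Hle[].
Qed.
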